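(* Let $X$ be a finite, linear semi-simplicial complex over $T^n$ whose vertices have pairwise distinct images. Then $X\cong X(F^\bullet)$ for some bounded sequence $F^\bullet$ of based finite-rank free $R_n$-modules and some choice of points $(x_i)_{i\in I}$ distinct modulo $\mathbb{Z}^n$ if and only if there exists a function $\deg:X_0\to\mathbb{Z}$ such that the following hold. (1) An edge $[x,y]\bmod\mathbb{Z}^n$ (with $x,y\in\mathbb{R}^n$) belongs to $X_1$ if and only if for some $k\ge1$ there exist $x_0=x,x_1,\dots,x_{k-1},x_k=y\in\mathbb{R}^n$ such that $[x_i]\bmod\mathbb{Z}^n$ belongs to $X_0$ for all $0\le i\le k$, and $[x_{i-1},x_i]\bmod\mathbb{Z}^n$ belongs to $X_1$ and has degree one for all $1\le i\le k$. (2) A $k$-simplex $[x_0,\dots,x_k]\bmod\mathbb{Z}^n$ with $k>1$ belongs to $X_k$ if and only if $[x_i]\bmod\mathbb{Z}^n$ belongs to $X_0$ for $0\le i\le k$ and $[x_{i-1},x_i]\bmod\mathbb{Z}^n$ belongs to $X_1$ for $1\le i\le k$.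
   Context: $R_n:=\mathbb{C}[z_1^{\pm1},\dots,z_n^{\pm1}]$, $T^n=\mathbb{R}^n/\mathbb{Z}^n$, $\pi:\mathbb{R}^n\to T^n$ is the projection, and $z^m=z_1^{m_1}\cdots z_n^{m_n}$ for $m\in\mathbb{Z}^n$. Semi-simplicial complexes. A semi-simplicial complex over $T^n$ is a collection $X=\{X_k\}_{k\in\mathbb{N}}$ where each $X_k$ is a set of maps $\sigma:\Delta^k\to T^n$ whose restriction to each $m$-dimensional face belongs to $X_m$. It is linear if each $\sigma$ is the restriction of $\pi$ to the convex hull of an ordered tuple of points of $\mathbb{R}^n$. For $y_0,\dots,y_k\in\mathbb{R}^n$, $[y_0,\dots,y_k]\bmod\mathbb{Z}^n$ is the map $\Delta^k\to T^n$ obtained by composing the linear map sending the vertices of $\Delta^k$ in order to $y_0,\dots,y_k$ with $\pi$. Given $\deg:X_0\to\mathbb{Z}$, the degree of an edge $\sigma:[0,1]\to T^n$ in $X_1$ is $\deg(\sigma(1))-\deg(\sigma(0))$. Sequences. $F^\bullet=\cdots\to F^k\xrightarrow{d^k}F^{k+1}\to\cdots$ is a bounded sequence of finite-rank free $R_n$-modules and homomorphisms (it is not required that $d^2=0$). It is based: for each $k$ there is a fixed finite set $I_k$ and an isomorphism $F^k\cong R_n^{\oplus I_k}$. $I:=\bigsqcup_k I_k$ and $\deg:I\to\mathbb{Z}$ is $\deg(i)=k$ for $i\in I_k$. For $i\in I_{k+1}$, $j\in I_k$, $d^k_{ij}\in R_n$ is the entry in row $i$, column $j$ of the matrix of $d^k$.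 Exponent sets $E_{ij}\subset\mathbb{Z}^n$ for $i,j\in I$: (a) if $\deg(i)\le\deg(j)$, $E_{ij}=\emptyset$; (b) if $\deg(i)=\deg(j)+1$, $E_{ij}$ is the set of exponents of $d^{\deg(j)}_{ij}$, i.e. $d^{\deg(j)}_{ij}=\sum_{m\in E_{ij}}c_{ijm}z^m$ with all $c_{ijm}\ne0$; (c) if $\deg(i)=\deg(j)+k$ with $k>1$, then $m\in E_{ij}$ iff $m=\sum_{\ell=1}^k m_\ell$ for some $i_1,\dots,i_{k-1}\in I$ with $\deg(i_\ell)=\deg(j)+\ell$ and some $(m_1,\dots,m_k)\in E_{i_1j}\times E_{i_2i_1}\times\cdots\times E_{i\,i_{k-1}}$. $X(F^\bullet)=\{X(F^\bullet)_k\}_{k\in\mathbb{N}}$ is defined, given points $x_i\in\mathbb{R}^n$ $(i\in I)$, by $$X(F^\bullet)_k:=\bigcup_{i_0,\dots,i_k\in I}\Big\{\big[x_{i_0},\,x_{i_1}+m_1,\,\dots,\,x_{i_k}+\textstyle\sum_{\ell=1}^k m_\ell\big]\bmod\mathbb{Z}^n \;:\;(m_1,\dots,m_k)\in E_{i_1i_0}\times\cdots\times E_{i_ki_{k-1}}\Big\},$$ with $X(F^\bullet)_0=\{[x_i]\bmod\mathbb{Z}^n\}_{i\in I}$. Here $X\cong X(F^\bullet)$ means that the two collections of simplices over $T^n$ coincide. *)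

(* Defs.v *)
From HB Require Import structures.
From mathcomp Require Import all_boot all_order all_algebra.
From mathcomp Require Import boolp classical_sets functions cardinality reals.
From mathcomp Require Import finmap complex.
From mathcomp Require Import monalg.

Set Implicit Arguments.
Unset Strict Implicit.
Unset Printing Implicit Defensive.

Import GRing.Theory Num.Theory.
Local Open Scope ring_scope.
Local Open Scope classical_set_scope.
Local Open Scope quotient_scope.

(* Laurent polynomials are finitely supported functions Z^n -> K with the
   convolution product: << c *g m >> is c z^m and p@_m is the coefficient of
   z^m in p.  The ring structure of monalg does not apply, since it is only
   available for exponent monoids without nontrivial units. *)
Definition laurent (K : comNzRingType) (n : nat) : Type :=
  {malg K['rV[int]_n]}.

Section LaurentRing.
Variables (K : comNzRingType) (n : nat).
Local Notation A := (laurent K n).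
Implicit Types (p q : A) (a b m : 'rV[int]_n) (c : K).

HB.instance Definition _ := GRing.Zmodule.on A.

Definition laurent1 : A := << 1 *g (0 : 'rV[int]_n) >>.

Definition laurentM p q : A :=
  \sum_(a <- msupp p) \sum_(b <- msupp q) << p@_a * q@_b *g a + b >>.

Lemma laurentMw (d1 d2 : {fset 'rV[int]_n}) p q :
  (msupp p `<=` d1)%fset -> (msupp q `<=` d2)%fset ->
  laurentM p q = \sum_(a <- d1) \sum_(b <- d2) << p@_a * q@_b *g a + b >>.
Proof.
move=> le1 le2; rewrite /laurentM (big_fset_incl _ le1) /=.
  apply/eq_bigr=> a _; apply/big_fset_incl => // b _ /mcoeff_outdom ->.
  by rewrite mulr0 monalgU0.
move=> a _ /mcoeff_outdom pa; rewrite big1 // => b _.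
by rewrite pa mul0r monalgU0.
Qed.

Lemma laurentMUU c1 c2 a b :
  laurentM << c1 *g a >> << c2 *g b >> = << c1 * c2 *g a + b >>.
Proof. by rewrite (laurentMw msuppU_le msuppU_le) !big_seq_fset1 !mcoeffUU. Qed.

Lemma laurentMC : commutative laurentM.
Proof.
move=> p q; rewrite /laurentM exchange_big /=.
by apply/eq_bigr=> a _; apply/eq_bigr=> b _; rewrite mulrC addrC.
Qed.

Lemma laurentMDl : left_distributive laurentM +%R.
Proof.
move=> p1 p2 q; pose d := (msupp p1 `|` msupp p2)%fset.
rewrite (@laurentMw d (msupp q)) ?msuppD_le ?fsubset_refl //.
rewrite (@laurentMw d (msupp q) p1) ?fsubsetUl ?fsubset_refl //.
rewrite (@laurentMw d (msupp q) p2) ?fsubsetUr ?fsubset_refl //.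
rewrite -big_split /=; apply/eq_bigr=> a _.
rewrite -big_split /=; apply/eq_bigr=> b _.
by rewrite mcoeffD mulrDl monalgUD.
Qed.

Lemma laurentM0l q : laurentM 0 q = 0.
Proof. by rewrite /laurentM msupp0 big_seq_fset0. Qed.

Lemma laurentM_suml (I : Type) (r : seq I) (F : I -> A) q :
  laurentM (\sum_(i <- r) F i) q = \sum_(i <- r) laurentM (F i) q.
Proof.
exact: (big_morph (laurentM^~ q) (fun x y => laurentMDl x y q) (laurentM0l q)).
Qed.

Lemma laurentM_sumr (I : Type) (r : seq I) (F : I -> A) p :
  laurentM p (\sum_(i <- r) F i) = \sum_(i <- r) laurentM p (F i).
Proof.
by rewrite laurentMC laurentM_suml; apply: eq_bigr => i _; rewrite laurentMC.
Qed.

Lemma laurentMA : associative laurentM.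
Proof.
move=> p q r; rewrite (monalgE p) laurentM_suml (laurentM_suml _ _ q).
rewrite (laurentM_suml _ _ r); apply: eq_bigr => a _.
rewrite (monalgE q) (laurentM_suml _ _ r) (laurentM_sumr (msupp q)).
rewrite (laurentM_sumr (msupp q)) laurentM_suml.
apply: eq_bigr => b _; rewrite (monalgE r) !(laurentM_sumr (msupp r)).
apply: eq_bigr => c _.
by rewrite !laurentMUU mulrA addrA.
Qed.

Lemma laurent1M : left_id laurent1 laurentM.
Proof.
move=> p; rewrite [RHS]monalgE [in LHS](monalgE p) laurentM_sumr.
by apply: eq_bigr => a _; rewrite laurentMUU mul1r add0r.
Qed.

Lemma laurent1_neq0 : laurent1 != 0.
Proof. by rewrite monalgU_eq0 oner_eq0. Qed.

HB.instance Definition _ := GRing.Zmodule_isComNzRing.Build A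
  laurentMA laurentMC laurent1M laurentMDl laurent1_neq0.

End LaurentRing.

Section Torus.
Variables (R : realType) (n : nat).

Definition int_lattice : {pred 'rV[R]_n} :=
  [pred x | x \is a mxOver Num.int].

Lemma int_lattice_zmod_closed : zmod_closed int_lattice.
Proof.
split=> [|x y]; rewrite !inE; first exact: mxOver0 (rpred0 _).
move=> /mxOverP xZ /mxOverP yZ; apply/mxOverP => i j.
by rewrite !mxE rpredB.
Qed.

HB.instance Definition _ :=
  GRing.isZmodClosed.Build 'rV[R]_n int_lattice int_lattice_zmod_closed.

Definition torus : Type := Quotient.quot int_lattice.

Definition torus_proj : 'rV[R]_n -> torus :=
  \pi_(Quotient.quot int_lattice).

End Torus.

Section Simplices.
Variable R : realType.

Definition in_simplex (k : nat) (t : 'rV[R]_k.+1) : bool :=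
  [forall i, 0 <= t 0 i] && (\sum_i t 0 i == 1).

Definition simplex (k : nat) : Type := {t : 'rV[R]_k.+1 | in_simplex t}.

(* the affine map sending the i-th vertex of Delta^m to the (f i)-th vertex of
   Delta^k, in barycentric coordinates *)
Definition face_coords (m k : nat) (f : 'I_m.+1 -> 'I_k.+1)
    (t : 'rV[R]_m.+1) : 'rV[R]_k.+1 :=
  \row_j \sum_(i | f i == j) t 0 i.

Lemma face_subproof (m k : nat) (f : 'I_m.+1 -> 'I_k.+1) (t : simplex m) :
  in_simplex (face_coords f (val t)).
Proof.
case: t => t /= /andP[/forallP t_ge0 /eqP t1]; apply/andP; split.
  by apply/forallP => j; rewrite mxE sumr_ge0.
rewrite -t1 (partition_big f xpredT) //=; apply/eqP/eq_bigr => j _.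
by rewrite mxE.
Qed.

Definition face (m k : nat) (f : 'I_m.+1 -> 'I_k.+1) (t : simplex m) :
  simplex k := exist _ (face_coords f (val t)) (face_subproof f t).

End Simplices.

Definition singular (R : realType) (n k : nat) : Type :=
  simplex R k -> torus R n.

Section Complexes.
Variables (R : realType) (n : nat).
Local Notation sing := (singular R n).
Implicit Type X : forall k, set (sing k).

Definition semisimplicial X : Prop :=
  forall (k m : nat) (f : 'I_m.+1 -> 'I_k.+1) (s : sing k),
    {homo f : i j / (i < j)%N} -> X k s -> X m (s \o face f).

(* finitely many simplices in total, all dimensions together *)
Definition finite_complex X : Prop :=
  finite_set [set s : {k : nat & sing k} | X (tag s) (tagged s)].

(* [y_0, ..., y_k] mod Z^n; the points y_i need not be affinely independent *)
Definition lin_simplex (k : nat) (y : k.+1.-tuple 'rV[R]_n) : sing k :=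
  fun t => torus_proj (\sum_(i < k.+1) val t 0 i *: tnth y i).

Definition linear_complex X : Prop :=
  forall (k : nat) (s : sing k), X k s ->
    exists y : k.+1.-tuple 'rV[R]_n, s = lin_simplex y.

Definition distinct_vertices X : Prop :=
  forall u v : sing 0, X 0%N u -> X 0%N v -> range u = range v -> u = v.

(* restriction of an edge to its initial (ord0) or final (ord_max) vertex *)
Definition edge_vertex (s : sing 1) (i : 'I_2) : sing 0 :=
  s \o face (fun=> i).

(* s has degree d, for an edge s both of whose vertices lie in X 0; deg is only
   defined on X 0, whence the relational form. *)
Definition has_degree X (deg : X 0%N -> int) (s : sing 1) (d : int) : Prop :=
  exists a b : X 0%N,
    [/\ val a = edge_vertex s ord0, val b = edge_vertex s ord_max
      & d = deg b - deg a].

Definition edges_generated X (deg : X 0%N -> int) : Prop :=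
  forall x y : 'rV[R]_n,
    X 1%N (lin_simplex [tuple x; y]) <->
    exists (k : nat) (p : k.+1.-tuple 'rV[R]_n),
      [/\ (1 <= k)%N, p`_0 = x, p`_k = y,
          forall i, (i <= k)%N -> X 0%N (lin_simplex [tuple p`_i])
        & forall i, (i < k)%N ->
            X 1%N (lin_simplex [tuple p`_i; p`_i.+1]) /\
            has_degree deg (lin_simplex [tuple p`_i; p`_i.+1]) 1].

Definition simplices_generated X : Prop :=
  forall (k : nat) (p : k.+1.-tuple 'rV[R]_n), (1 < k)%N ->
    X k (lin_simplex p) <->
    (forall i, (i <= k)%N -> X 0%N (lin_simplex [tuple p`_i])) /\
    (forall i, (i < k)%N -> X 1%N (lin_simplex [tuple p`_i; p`_i.+1])).

End Complexes.

Section Sequences.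
Variables (R : realType) (n : nat).
Local Notation Rn := (laurent R[i] n).

Record based_sequence := BasedSequence {
  seq_mod : int -> lmodType Rn;
  seq_diff : forall k, {linear seq_mod k -> seq_mod (k + 1)};
  basis_index : int -> finType;
  coords : forall k, {linear seq_mod k -> {ffun basis_index k -> Rn^o}};
  of_coords : forall k, {ffun basis_index k -> Rn^o} -> seq_mod k;
  coordsK : forall k, cancel (coords k) (@of_coords k);
  of_coordsK : forall k, cancel (@of_coords k) (coords k);
  seq_bounded : exists N : nat, forall k : int, (N < `|k|)%N ->
    forall v : seq_mod k, v = 0
}.

(* the disjoint union of the basis index sets; the degree of i is tag i *)
Definition indices (F : based_sequence) : Type := {k : int & basis_index F k}.

Section FixSequence.
Variable F : based_sequence.
Implicit Types i j : indices F.

Definition basis (k : int) (j : basis_index F k) : seq_mod F k :=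
  of_coords [ffun j' => (j' == j)%:R].

Definition mx_entry (k : int) (i : basis_index F (k + 1))
    (j : basis_index F k) : Rn :=
  coords F (k + 1) (seq_diff F k (basis j)) i.

Definition degree_one_exponents i j : set 'rV[int]_n :=
  [set m | exists e : tag i = tag j + 1,
             m \in msupp (mx_entry (etagged e) (tagged j))].

(* The exponent set E_ij: the first disjunct is the case
   deg i = deg j + 1 and the second the case deg i = deg j + k with k > 1, so
   that E_ij is empty when deg i <= deg j. *)
Definition exponents i j : set 'rV[int]_n :=
  [set m | degree_one_exponents i j m \/
    exists (k : nat) (s : 'I_k.+1 -> indices F) (u : 'I_k -> 'rV[int]_n),
      [/\ (1 < k)%N /\ tag i = tag j + k%:Z,
          s ord0 = j /\ s ord_max = i,
          forall l : 'I_k.+1, tag (s l) = tag j + (l : nat)%:Z,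
          forall l : 'I_k, degree_one_exponents
            (s (lift ord0 l)) (s (widen_ord (leqnSn k) l)) (u l)
        & m = \sum_l u l]].

(* For k = 0 this is the set of the vertices [x_i] mod Z^n. *)
Definition seq_complex (x : indices F -> 'rV[R]_n) (k : nat) :
    set (singular R n k) :=
  [set c | exists (s : 'I_k.+1 -> indices F) (u : 'I_k -> 'rV[int]_n),
     (forall l : 'I_k, exponents
        (s (lift ord0 l)) (s (widen_ord (leqnSn k) l)) (u l)) /\
     c = lin_simplex [tuple x (s l) +
                       map_mx intr (\sum_(r < k | (r < l)%N) u r) | l < k.+1]].

End FixSequence.
End Sequences.

Arguments seq_complex {R n F} x k _.

(* Main.v *)
(* The map [y_0, ..., y_k] mod Z^n determines (y_0, ..., y_k) up to a common
   lattice translation.  Since the x_i are distinct mod Z^n, each lift of a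
   vertex is x_i + a for a unique pair (i, a), and a simplex of X(F) is the same
   thing as a sequence of labels (i_l, a_l) with a_{l+1} - a_l in
   E_{i_{l+1} i_l}.  So membership in X(F)_k is tested on consecutive edges, and
   the edges are generated by those of degree one, which encode the exponents of
   the matrices d^k.  Conversely, the degree-one edges of X prescribe the
   supports of the entries of d^k, all coefficients being taken equal to 1. *)
Require Import Defs.
From HB Require Import structures.
From mathcomp Require Import all_boot all_order all_algebra.
From mathcomp Require Import boolp classical_sets functions cardinality reals.
From mathcomp Require Import finmap complex monalg.
From mathcomp Require Import zify ring lra.

Set Implicit Arguments.
Unset Strict Implicit.
Unset Printing Implicit Defensive.

Import Order.TTheory GRing.Theory Num.Theory.
Local Open Scope ring_scope.
Local Open Scope classical_set_scope.

(** * Lattice translations and lifts of linear simplices *)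

Section LinearSimplices.
Variables (R : realType) (n : nat).
Implicit Types (x y : 'rV[R]_n) (a b m : 'rV[int]_n).

Local Notation shift m := (map_mx intr m : 'rV[R]_n).

Lemma int_latticeP x : reflect (exists a, x = shift a) (x \in @int_lattice R n).
Proof.
apply: (iffP idP) => [/mxOverP xZ|[a ->]].
  exists (map_mx Num.floor x); apply/rowP => j; rewrite !mxE.
  by apply/esym/eqP; rewrite -intrEfloor.
by apply/mxOverP => i j; rewrite mxE intr_int.
Qed.

Lemma torus_projP x y :
  torus_proj x = torus_proj y <-> exists a, y = x + shift a.
Proof.
rewrite /torus_proj; split=> [/eqP|[a ->]].
  rewrite eq_sym -Quotient.idealrBE => /int_latticeP[a ya]; exists a.
  by rewrite -ya addrC subrK.
apply/esym/eqP; rewrite -Quotient.idealrBE; apply/int_latticeP; exists a.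
by rewrite addrAC subrr add0r.
Qed.

Lemma shift_inj : injective (fun m => shift m).
Proof.
move=> a b /rowP ab; apply/rowP => j.
by move: (ab j); rewrite !mxE => /intr_inj.
Qed.

(** Barycentric coordinates on the edge from vertex 0 to vertex [l]. Adding the two indicators keeps
    [l = ord0] uniform: the point is then vertex 0 for every [t]. *)
Definition segment_coords k (l : 'I_k.+1) (t : R) : 'rV[R]_k.+1 :=
  \row_j ((1 - t) * (j == ord0)%:R + t * (j == l)%:R).

Fact segment_subproof k (l : 'I_k.+1) (t : R) (t01 : 0 <= t <= 1) :
  in_simplex (segment_coords l t).
Proof.
case/andP: t01 => t0 t1; apply/andP; split.
  apply/forallP => j; rewrite mxE addr_ge0 ?mulr_ge0 ?ler0n //.
  by rewrite subr_ge0.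
under eq_bigr do rewrite mxE.
rewrite big_split /= -!mulr_sumr (bigD1 ord0) //= big1 => [|i /negPf-> //].
rewrite (bigD1 l) //= big1 => [|i /negPf-> //].
by rewrite !eqxx !addr0 !mulr1 subrK.
Qed.

Definition segment_point k (l : 'I_k.+1) t (t01 : 0 <= t <= 1) : simplex R k :=
  exist _ (segment_coords l t) (segment_subproof l t01).

Lemma lin_simplex_segment k (p : k.+1.-tuple 'rV[R]_n) l t
    (t01 : 0 <= t <= 1) :
  lin_simplex p (segment_point l t01) =
  torus_proj ((1 - t) *: tnth p ord0 + t *: tnth p l).
Proof.
have delta i : \sum_(j < k.+1) (j == i)%:R *: tnth p j = tnth p i.
  rewrite (bigD1 i) //= eqxx scale1r big1 ?addr0 // => j /negPf->.
  by rewrite scale0r.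
rewrite /lin_simplex /=; congr (torus_proj _).
under eq_bigr do rewrite mxE scalerDl -!scalerA.
by rewrite big_split -!scaler_sumr /= !delta.
Qed.

(* On the segment from vertex 0 to vertex l the two lifts differ by a path in
   the discrete set Z^n, so this difference is the same at both ends. *)
Lemma lin_simplex_eqP k (p q : k.+1.-tuple 'rV[R]_n) :
  lin_simplex p = lin_simplex q <->
  exists a, forall l, tnth q l = tnth p l + shift a.
Proof.
split=> [pq|[a qa]]; last first.
  apply/funext => t; apply/torus_projP; exists a.
  under eq_bigr do rewrite qa scalerDr.
  rewrite big_split -scaler_suml; congr (_ + _).
  by case/andP: (valP t) => _ /eqP /= ->; rewrite scale1r.
have seg l t (t01 : 0 <= t <= 1) :
    (1 - t) *: (tnth q ord0 - tnth p ord0) + t *: (tnth q l - tnth p l)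
    \in @int_lattice R n.
  have := congr1 (@^~ (segment_point l t01)) pq.
  rewrite /= !lin_simplex_segment.
  move=> /torus_projP[a qa]; apply/int_latticeP; exists a.
  by rewrite !scalerBr addrACA qa -opprD addrAC subrr add0r.
have t00 : 0 <= (0 : R) <= 1 by rewrite lexx ler01.
have /int_latticeP[a qp0] := seg ord0 _ t00.
move: qp0; rewrite scale0r addr0 subr0 scale1r => qp0.
exists a => l; rewrite -qp0.
suff -> : tnth q ord0 - tnth p ord0 = tnth q l - tnth p l.
  by rewrite addrC subrK.
move: seg => /(_ l); move: (_ - _) => D; move: (_ - _) => E seg.
apply/rowP => j; apply: contrapT => /eqP DE.
have int t : 0 <= t <= 1 -> (1 - t) * D 0 j + t * E 0 j \is a Num.int.
  by move=> /seg/mxOverP/(_ 0 j); rewrite !mxE.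
have D_int : D 0 j \is a Num.int.
  by have := int _ t00; rewrite subr0 mul1r mul0r addr0.
have E_int : E 0 j \is a Num.int.
  by have := int 1; rewrite ler01 lexx subrr mul0r mul1r add0r; exact.
have d_int : E 0 j - D 0 j \is a Num.int by rewrite rpredB.
have d_neq0 : E 0 j - D 0 j != 0 by rewrite subr_eq0 eq_sym.
have d_ge1 : 1 <= `|E 0 j - D 0 j| by rewrite norm_intr_ge1.
(* At this [t] coordinate [j] has moved by exactly 1/2 from an integer; [t <= 1] because the integer
   [E 0 j - D 0 j] is nonzero. *)
pose t := (2 * `|E 0 j - D 0 j|)^-1.
have t01 : 0 <= t <= 1.
  rewrite invr_ge0 mulr_ge0 //= invf_le1; lra.
have td_int : t * (E 0 j - D 0 j) \is a Num.int.
  have -> : t * (E 0 j - D 0 j) = ((1 - t) * D 0 j + t * E 0 j) - D 0 j by ring.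
  by rewrite rpredB //; apply: int.
have half : t * `|E 0 j - D 0 j| \is a Num.int.
  by case: (ger0P (E 0 j - D 0 j)) => _ //; rewrite mulrN rpredN.
have : t * `|E 0 j - D 0 j| = 2^-1.
  by rewrite /t invfM -mulrA mulVf ?mulr1 // normr_eq0.
move=> th; move: half; rewrite th => /norm_intr_ge1.
rewrite invr_eq0 pnatr_eq0 => /(_ isT).
rewrite ger0_norm; lra.
Qed.

Lemma lin_simplex_face (k m : nat) (p : k.+1.-tuple 'rV[R]_n)
    (f : 'I_m.+1 -> 'I_k.+1) :
  lin_simplex p \o face f = lin_simplex [tuple tnth p (f i) | i < m.+1].
Proof.
apply/funext => t; rewrite /lin_simplex /=; congr (torus_proj _).
rewrite [RHS](partition_big f xpredT) //=; apply: eq_bigr => j _.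
rewrite mxE scaler_suml; apply: eq_bigr => i /eqP fi.
by rewrite tnth_mktuple fi.
Qed.

Lemma edge_vertex0 x y :
  edge_vertex (lin_simplex [tuple x; y]) ord0 = lin_simplex [tuple x].
Proof.
rewrite /edge_vertex lin_simplex_face; congr lin_simplex.
by apply: eq_from_tnth => i; rewrite (ord1 i) tnth_mktuple.
Qed.

Lemma edge_vertex1 x y :
  edge_vertex (lin_simplex [tuple x; y]) ord_max = lin_simplex [tuple y].
Proof.
rewrite /edge_vertex lin_simplex_face; congr lin_simplex.
by apply: eq_from_tnth => i; rewrite (ord1 i) tnth_mktuple.
Qed.

Lemma lin_vertex_eqP x y :
  lin_simplex [tuple x] = lin_simplex [tuple y] <-> exists a, y = x + shift a.
Proof.
rewrite lin_simplex_eqP; split=> -[a xy]; exists a; first exact: (xy ord0).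
by move=> l; rewrite (ord1 l).
Qed.

Lemma lin_edge_eqP x y x' y' :
  lin_simplex [tuple x; y] = lin_simplex [tuple x'; y'] <->
  exists a, x' = x + shift a /\ y' = y + shift a.
Proof.
rewrite lin_simplex_eqP; split=> -[a xy]; exists a.
  by split; [exact: (xy ord0) | exact: (xy (lift ord0 ord0))].
by case: xy => x'E y'E l; case: l => [[|[|//]] i]; rewrite !(tnth_nth 0).
Qed.

Lemma vertex_tuple (p : 1.-tuple 'rV[R]_n) : p = [tuple tnth p ord0].
Proof. by apply: eq_from_tnth => l; rewrite (ord1 l). Qed.

Lemma edge_tuple (p : 2.-tuple 'rV[R]_n) :
  p = [tuple tnth p ord0; tnth p ord_max].
Proof.
apply: eq_from_tnth => -[[|[|//]] i]; rewrite [RHS](tnth_nth 0) /=;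
  congr tnth; exact/val_inj.
Qed.

End LinearSimplices.

(** * Sums over initial segments of ordinals *)

Section PartialSums.
Variables (V : zmodType) (k : nat).

Lemma big_ord_ltnS (u : 'I_k -> V) (l : 'I_k) :
  \sum_(r < k | (r < l.+1)%N) u r = \sum_(r < k | (r < l)%N) u r + u l.
Proof.
rewrite (bigD1 l) //= addrC; congr (_ + _); apply: eq_bigl => r.
by rewrite ltnS ltn_neqAle andbC.
Qed.

Lemma telescope_ord_lt (a : 'I_k.+1 -> V) (l : 'I_k.+1) :
  \sum_(r < k | (r < l)%N) (a (lift ord0 r) - a (widen_ord (leqnSn k) r)) =
  a l - a ord0.
Proof.
case: l => l /=; elim: l => [|l IH] lk.
  rewrite big1 // (_ : Ordinal lk = ord0) ?subrr //; exact: val_inj.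
rewrite (big_ord_ltnS _ (Ordinal (lk : (l < k)%N))) /= (IH (ltnW lk)).
rewrite addrC (_ : lift _ _ = Ordinal lk); last exact: val_inj.
rewrite (_ : widen_ord _ _ = Ordinal (ltnW lk)); last exact: val_inj.
by rewrite addrA subrK.
Qed.

End PartialSums.

(** The right-hand side of the edge condition with the set [D] of admissible steps left free, so
    that it can be used before a degree function on vertices is available. *)
Definition edge_chain (R : realType) (n : nat) (V : set (singular R n 0))
    (D : set (singular R n 1)) (x y : 'rV[R]_n) : Prop :=
  exists (k : nat) (p : k.+1.-tuple 'rV[R]_n),
    [/\ (1 <= k)%N, p`_0 = x, p`_k = y,
        forall i, (i <= k)%N -> V (lin_simplex [tuple p`_i])
      & forall i, (i < k)%N -> D (lin_simplex [tuple p`_i; p`_i.+1])].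

(** * Labels, simplices and generating edges of the complex of a sequence *)

Section SequenceComplex.
Variables (R : realType) (n : nat) (F : based_sequence R n).
Variable x : indices F -> 'rV[R]_n.
Hypothesis x_inj : injective (fun i => torus_proj (x i)).
Implicit Types (i j : indices F) (a b m : 'rV[int]_n) (p q : 'rV[R]_n).

Local Notation shift m := (map_mx intr m : 'rV[R]_n).
Local Notation Y := (seq_complex x).

Lemma label_inj i j a b :
  x i + shift a = x j + shift b -> i = j /\ a = b.
Proof.
move=> E; have ij : i = j.
  apply: x_inj; apply/torus_projP; exists (a - b).
  by rewrite map_mxB addrA E addrK.
by split=> //; move: E; rewrite ij => /addrI/shift_inj.
Qed.

(** Trades the increments [u] of the definition for absolute translations [a]: the partial sums of
    [u], plus the translation relating the two lifts, give [a], and the successive differences of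
    [a] give back [u]. *)
Lemma seq_complexP k (p : k.+1.-tuple 'rV[R]_n) :
  Y k (lin_simplex p) <->
  exists (s : 'I_k.+1 -> indices F) (a : 'I_k.+1 -> 'rV[int]_n),
    (forall l, tnth p l = x (s l) + shift (a l)) /\
    forall l : 'I_k, exponents (s (lift ord0 l)) (s (widen_ord (leqnSn k) l))
      (a (lift ord0 l) - a (widen_ord (leqnSn k) l)).
Proof.
split=> [[s [u [su /esym/lin_simplex_eqP[c pc]]]]|[s [a [pa sa]]]].
  exists s, (fun l => \sum_(r < k | (r < l)%N) u r + c); split=> l.
    by rewrite pc tnth_mktuple -addrA map_mxD.
  rewrite opprD addrACA subrr addr0 lift0 big_ord_ltnS addrAC subrr add0r.
  exact: su.
exists s, (fun l => a (lift ord0 l) - a (widen_ord (leqnSn k) l)); split=> //.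
apply/esym/lin_simplex_eqP; exists (a ord0) => l.
by rewrite tnth_mktuple telescope_ord_lt -addrA -map_mxD subrK.
Qed.

Lemma seq_complex_linear : linear_complex Y.
Proof. by move=> k c [s [u [_ ->]]]; eexists. Qed.

Lemma seq_complex_vertexP p :
  Y 0 (lin_simplex [tuple p]) <-> exists i a, p = x i + shift a.
Proof.
rewrite seq_complexP; split=> [[s [a [pa _]]]|[i [a pa]]].
  by exists (s ord0), (a ord0); rewrite -pa.
by exists (fun=> i), (fun=> a); split=> [l|[]//]; rewrite (ord1 l).
Qed.

Lemma seq_complex_lift i a : Y 0 (lin_simplex [tuple x i + shift a]).
Proof. by apply/seq_complex_vertexP; exists i, a. Qed.

Lemma seq_complex_edgeP p q :
  Y 1 (lin_simplex [tuple p; q]) <->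
  exists i j a b, [/\ p = x i + shift a, q = x j + shift b
                    & exponents j i (b - a)].
Proof.
rewrite seq_complexP; split=> [[s [a [pa sa]]]|[i [j [a [b [pa qb ab]]]]]].
  exists (s ord0), (s ord_max), (a ord0), (a ord_max); split.
  - by rewrite -pa.
  - by rewrite -pa.
  - move: (sa ord0); rewrite (_ : lift _ _ = ord_max); last exact: val_inj.
    by rewrite (_ : widen_ord _ _ = ord0) //; exact: val_inj.
exists (fun l => if l == ord0 then i else j).
exists (fun l => if l == ord0 then a else b).
by split=> [|l]; [case=> [[|[|//]] l]; rewrite (tnth_nth 0)|rewrite (ord1 l)].
Qed.

Lemma seq_complex_edge_lift i j a b :
  Y 1 (lin_simplex [tuple x i + shift a; x j + shift b]) <->
  exponents j i (b - a).
Proof.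
rewrite seq_complex_edgeP; split=> [|ij]; last by exists i, j, a, b.
by move=> [i' [j' [a' [b' [/label_inj[-> ->] /label_inj[-> ->]]]]]].
Qed.

(** The edges given by single monomials of the differentials. The source is normalized to [x i]; as
    for matrix entries, the target [j] is the row index. *)
Definition unit_edges : set (singular R n 1) :=
  [set c | exists i j m, degree_one_exponents j i m /\
             c = lin_simplex [tuple x i; x j + shift m]].

Lemma unit_edges_lift i j a b :
  unit_edges (lin_simplex [tuple x i + shift a; x j + shift b]) <->
  degree_one_exponents j i (b - a).
Proof.
split=> [[i' [j' [m [ij' /lin_edge_eqP[c []]]]]]|ij].
  (* With [x i'] written as a translate by 0, [label_inj] applies at both ends; the source gives
     [a = - c]. *)
  rewrite -[x i'](addr0) -(map_mx0 intr) -!addrA -!map_mxD.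
  move=> /label_inj[? /esym/eqP]; rewrite addr_eq0 => /eqP ->.
  by move=> /label_inj[? ?]; subst i' j' m; rewrite opprK.
exists i, j, (b - a); split=> //; apply/lin_edge_eqP; exists (- a).
by rewrite map_mxN addrK map_mxB addrA.
Qed.

Lemma seq_complex_labels k (p : 'I_k.+1 -> 'rV[R]_n) :
  (forall l, Y 0 (lin_simplex [tuple p l])) ->
  exists (s : 'I_k.+1 -> indices F) (a : 'I_k.+1 -> 'rV[int]_n),
    forall l, p l = x (s l) + shift (a l).
Proof.
move=> Yp; have /choice[f fp] l : exists ia, p l = x ia.1 + shift ia.2.
  by have /seq_complex_vertexP[i [a pa]] := Yp l; exists (i, a).
by exists (fst \o f), (snd \o f).
Qed.

Lemma degree_one_exponents_tag i j m :
  degree_one_exponents i j m -> tag i = tag j + 1.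
Proof. by case. Qed.

(** A composite of [k > 1] differentials raises the degree by [k], so only the first disjunct of
    [exponents] is left. *)
Lemma exponents_degree1 i j m :
  tag i = tag j + 1 -> exponents i j m -> degree_one_exponents i j m.
Proof.
by move=> ij [//|[k [s [u [[k1 ijk] _ _ _ _]]]]]; lia.
Qed.

(** Since labels are unique, labels chosen once for all vertices are those seen by every consecutive
    edge; the edge conditions thus become the exponent conditions of [seq_complexP]. *)
Lemma seq_complex_simplices_generated : simplices_generated Y.
Proof.
move=> k p k1; rewrite seq_complexP; split=> [[s [a [pa sa]]]|[Yp Yp1]].
  split=> i ik.
    have -> : p`_i = tnth p (Ordinal (ik : (i < k.+1)%N)).
      by rewrite (tnth_nth 0).
    by rewrite pa; exact: seq_complex_lift.
  have -> : p`_i = tnth p (widen_ord (leqnSn k) (Ordinal ik)).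
    by rewrite (tnth_nth 0).
  have -> : p`_i.+1 = tnth p (lift ord0 (Ordinal ik)) by rewrite (tnth_nth 0).
  by rewrite !pa; apply/seq_complex_edge_lift.
have [|s [a pa]] := @seq_complex_labels k (tnth p).
  by move=> l; rewrite (tnth_nth 0); apply: Yp; rewrite -ltnS.
exists s, a; split=> // l; apply/seq_complex_edge_lift; rewrite -!pa.
by rewrite !(tnth_nth 0) /=; exact: Yp1.
Qed.

(** Chains of [unit_edges] are composable strings of monomials; length one and length greater than
    one correspond to the two disjuncts of [exponents]. *)
Lemma seq_complex_edges_generated p q :
  Y 1 (lin_simplex [tuple p; q]) <-> edge_chain (Y 0) unit_edges p q.
Proof.
split=> [/seq_complex_edgeP[i [j [a [b [-> -> []]]]]]|].
- move=> ij; exists 1%N, [tuple x i + shift a; x j + shift b]; split=> //.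
    by case=> [|[|//]] _; exact: seq_complex_lift.
  by case=> [|//] _; apply/unit_edges_lift.
- move=> [k [s [u [[k1 _] [s0 sk] st su ba]]]].
  (* Translation of the [l]-th vertex of the chain: it starts at [a], grows by the successive
     exponents and ends at [b]. *)
  pose c (l : 'I_k.+1) := a + \sum_(r < k | (r < l)%N) u r.
  pose t := [tuple x (s l) + shift (c l) | l < k.+1].
  have tE (l : 'I_k.+1) : t`_l = x (s l) + shift (c l).
    by rewrite -tnth_nth tnth_mktuple.
  exists k, t; split; first exact: ltnW.
  + by rewrite (tE ord0) s0 /c big1 // addr0.
  + rewrite (tE ord_max) sk /c; congr (_ + map_mx _ _).
    rewrite -[b](subrK a) ba addrC; congr (_ + _); apply: eq_bigl => r.
    by rewrite ltn_ord.
  + move=> l lk; rewrite (tE (Ordinal (lk : (l < k.+1)%N))).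
    exact: seq_complex_lift.
  + move=> l lk; rewrite (tE (widen_ord (leqnSn k) (Ordinal lk))).
    rewrite (tE (lift ord0 (Ordinal lk))); apply/unit_edges_lift.
    rewrite /c lift0 big_ord_ltnS opprD addrACA subrr add0r addrAC subrr add0r.
    exact: su.
- move=> [k [t [k0 <- <- Yt Dt]]].
  have [|s [a ta]] := @seq_complex_labels k (tnth t).
    by move=> l; rewrite (tnth_nth 0); apply: Yt; rewrite -ltnS.
  have sa (l : 'I_k) : degree_one_exponents (s (lift ord0 l))
      (s (widen_ord (leqnSn k) l))
      (a (lift ord0 l) - a (widen_ord (leqnSn k) l)).
    by apply/unit_edges_lift; rewrite -!ta !(tnth_nth 0) /=; exact: Dt.
  have -> : t`_0 = tnth t ord0 by rewrite (tnth_nth 0).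
  have -> : t`_k = tnth t ord_max by rewrite (tnth_nth 0).
  rewrite !ta; apply/seq_complex_edge_lift.
  have st (l : 'I_k.+1) : tag (s l) = tag (s ord0) + (l : nat)%:Z.
    case: l => l /=; elim: l => [|l IH] lk.
      by rewrite addr0 (_ : Ordinal lk = ord0) //; exact: val_inj.
    have /degree_one_exponents_tag := sa (Ordinal (lk : (l < k)%N)).
    rewrite (_ : lift _ _ = Ordinal lk); last exact: val_inj.
    rewrite (_ : widen_ord _ _ = Ordinal (ltnW lk)); last exact: val_inj.
    by move=> ->; rewrite IH -addrA -PoszD addn1.
  (* A chain of length one must go to the first disjunct, since the second demands [1 < k]. *)
  move: k0; rewrite leq_eqVlt => /orP[/eqP k1|k1]; last first.
    right; exists k, s.
    exists (fun l => a (lift ord0 l) - a (widen_ord (leqnSn k) l)).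
    split=> //.
    by rewrite -telescope_ord_lt; apply: eq_bigl => r; rewrite ltn_ord.
  left; subst k; have := sa ord0.
  rewrite (_ : lift _ _ = ord_max); last exact: val_inj.
  by rewrite (_ : widen_ord _ _ = ord0) //; exact: val_inj.
Qed.

End SequenceComplex.

(** * Degree-one edges for a degree function compatible with the labels *)

Section DegreeCompatible.
Variables (R : realType) (n : nat) (F : based_sequence R n).
Variable x : indices F -> 'rV[R]_n.
Hypothesis x_inj : injective (fun i => torus_proj (x i)).
Variable X : forall k, set (singular R n k).
Arguments X : clear implicits.
Variable deg : X 0%N -> int.
Hypothesis X_vertices : X 0%N = seq_complex x 0.
Hypothesis deg_tag : forall (v : X 0%N) i,
  val v = lin_simplex [tuple x i] -> deg v = tag i.
Implicit Types (i j : indices F) (a b m : 'rV[int]_n).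

Local Notation shift m := (map_mx intr m : 'rV[R]_n).

(** A lattice translation does not change a vertex, so only the labels of the endpoints matter. *)
Lemma has_degree_lift i j a b (d : int) :
  has_degree deg (lin_simplex [tuple x i + shift a; x j + shift b]) d <->
  d = tag j - tag i.
Proof.
have vertexE h c : lin_simplex [tuple x h + shift c] = lin_simplex [tuple x h].
  by apply/esym/lin_vertex_eqP; exists c.
have vertexX h : lin_simplex [tuple x h] \in X 0%N.
  by apply: mem_set; rewrite -(vertexE h 0) X_vertices; exact: seq_complex_lift.
rewrite /has_degree edge_vertex0 edge_vertex1 !vertexE.
split=> [[u [v [/deg_tag -> /deg_tag -> ->]]]//|->].
pose w h : X 0%N := exist (fun v => v \in X 0%N) _ (vertexX h).
by exists (w i), (w j); rewrite !(@deg_tag (w _) _ erefl).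
Qed.

(** Serves both directions: for [X] the complex of [F], and for the [X] from which [F] is built.
    Testing edges that start at a chosen lift [x i] suffices, as every degree-one edge can be
    translated to such a start. *)
Lemma unit_edgesE (X_linear : linear_complex X) :
  (forall i j m, degree_one_exponents j i m <->
     tag j = tag i + 1 /\ X 1%N (lin_simplex [tuple x i; x j + shift m])) ->
  unit_edges x = [set c | X 1%N c /\ has_degree deg c 1].
Proof.
move=> E; apply/seteqP; split=> c.
  move=> [i [j [m [/E[ij Xc] ->]]]]; split=> //.
  rewrite -[x i](addr0) -(map_mx0 intr); apply/has_degree_lift.
  by rewrite ij addrAC subrr add0r.
move=> [Xc cd]; have [p pE] := X_linear _ _ Xc.
move: pE; rewrite (edge_tuple p) => pE; move: Xc cd; rewrite pE.
move: (tnth p ord0) (tnth p ord_max) => y z Xc cd.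
(* [has_degree] carries the membership of both endpoints in [X 0], hence their labels. *)
have [u [v [uE vE _]]] := cd.
have labelled (w : X 0%N) : seq_complex x 0 (val w).
  by rewrite -X_vertices; exact: set_mem (valP w).
move: (labelled u) (labelled v); rewrite uE vE edge_vertex0 edge_vertex1.
move=> /seq_complex_vertexP[i [a ya]] /seq_complex_vertexP[j [b zb]].
move: Xc cd; rewrite ya zb => Xc /has_degree_lift d.
apply/(unit_edges_lift x_inj)/E; split; first by rewrite d addrC subrK.
rewrite (_ : lin_simplex _ =
             lin_simplex [tuple x i + shift a; x j + shift b]) //.
by apply/lin_edge_eqP; exists a; rewrite map_mxB -addrA subrK.
Qed.

End DegreeCompatible.

(** The degree of a vertex is that of its label, which is unique; the degree-one edges are then
    exactly the [unit_edges]. *)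
Lemma generated_of_seq_complex (R : realType) (n : nat) (F : based_sequence R n)
    (x : indices F -> 'rV[R]_n)
    (x_inj : injective (fun i => torus_proj (x i))) :
  exists deg : seq_complex x 0 -> int,
    edges_generated deg /\ simplices_generated (seq_complex x).
Proof.
have /choice[f fE] (v : seq_complex x 0) :
    exists i, val v = lin_simplex [tuple x i].
  have Yv : seq_complex x 0 (val v) := set_mem (valP v).
  have [p pE] := seq_complex_linear Yv.
  move: Yv; rewrite pE (vertex_tuple p) => /seq_complex_vertexP[i [a ->]].
  by exists i; apply/esym/lin_vertex_eqP; exists a.
exists (fun v => tag (f v)); split; last exact: seq_complex_simplices_generated.
move=> p q; rewrite (seq_complex_edges_generated x_inj).
rewrite (@unit_edgesE _ _ _ _ x_inj _ (fun v => tag (f v))) //.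
- move=> v i; rewrite fE => /lin_vertex_eqP[a].
  by rewrite -[x i](addr0) -(map_mx0 intr) => /(label_inj x_inj)[<- _].
- exact: seq_complex_linear.
- move=> i j m.
  have -> : lin_simplex [tuple x i; x j + map_mx intr m] =
     lin_simplex [tuple x i + map_mx intr 0; x j + map_mx intr m].
    by rewrite map_mx0 addr0.
  rewrite (seq_complex_edge_lift x_inj) subr0.
  split=> [ij|[ij /(exponents_degree1 ij)//]].
  by split; [exact: degree_one_exponents_tag ij|left].
Qed.

(** * Based sequences with prescribed matrices and supports *)

Section FfunLinear.
Variables (K : comNzRingType) (I J : finType) (d : J -> I -> K).

Definition ffun_mulmx (v : {ffun I -> K^o}) : {ffun J -> K^o} :=
  [ffun i => \sum_j d i j * v j].

Fact ffun_mulmx_is_linear : linear ffun_mulmx.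
Proof.
move=> c u v; apply/ffunP => i; rewrite !ffunE scaler_sumr -big_split /=.
by apply: eq_bigr => j _; rewrite !ffunE mulrDr /GRing.scale /= mulrCA.
Qed.

HB.instance Definition _ :=
  GRing.isLinear.Build K {ffun I -> K^o} {ffun J -> K^o} _
    ffun_mulmx ffun_mulmx_is_linear.

Lemma ffun_mulmx_delta (i : J) (j : I) :
  ffun_mulmx [ffun j' => (j' == j)%:R] i = d i j.
Proof.
rewrite ffunE (bigD1 j) //= ffunE eqxx mulr1.
by rewrite big1 ?addr0 // => j' /negPf jj'; rewrite ffunE jj' mulr0.
Qed.

End FfunLinear.

Section MatrixSequence.
Variables (R : realType) (n : nat) (I : int -> finType).
Local Notation Rn := (laurent R[i] n).
Variable d : forall k, I (k + 1) -> I k -> Rn.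
Hypothesis I_bounded : exists N : nat, forall k, (N < `|k|)%N -> I k -> False.

Fact matrix_sequence_bounded : exists N : nat, forall k : int, (N < `|k|)%N ->
  forall v : {ffun I k -> Rn^o}, v = 0.
Proof.
have [N IN] := I_bounded; exists N => k kN v; apply/ffunP => i.
by case: (IN k kN i).
Qed.

Definition matrix_sequence : based_sequence R n :=
  @BasedSequence R n (fun k => {ffun I k -> Rn^o})
    (fun k => ffun_mulmx (@d k)) I
    (fun k => idfun) (fun k => idfun) (fun k v => erefl) (fun k v => erefl)
    matrix_sequence_bounded.

Lemma matrix_sequence_entry k (i : I (k + 1)) (j : I k) :
  @mx_entry R n matrix_sequence k i j = d i j.
Proof. exact: ffun_mulmx_delta. Qed.

End MatrixSequence.

(** The coefficient 1 is nonzero in [K], so the support is exactly [A]. *)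
Definition laurent_of_support (K : comNzRingType) (n : nat)
    (A : {fset 'rV[int]_n}) :  laurent K n := [malg m in A => 1].

Lemma msupp_laurent_of_support (K : comNzRingType) n
    (A : {fset 'rV[int]_n}) m :
  (m \in msupp (laurent_of_support K A)) = (m \in A).
Proof.
by rewrite -mcoeff_neq0 mcoeffE; case: ifP; rewrite ?oner_eq0 ?eqxx.
Qed.

(** Turns the vertices into a [finType] that can index bases; [{classic T}] equips an arbitrary type
    with classical equality and choice. *)
Lemma finite_set_enum (T : Type) (A : set T) :
  finite_set A -> exists (V : finType) (v : V -> T), injective v /\ A = range v.
Proof.
move=> Afin; have [B AB] : exists B : {fset {classic T}}, A = [set` B].
  exact/(@finite_fsetP {classic T}).
exists B, (fun u => val u); split; first exact: val_inj.
rewrite AB; apply/seteqP; split=> [u uB|_ [u _ <-]]; last exact: fsvalP.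
by exists (FSetSub uB).
Qed.

(** Proofs of equality between integers are unique, so the cast in [degree_one_exponents] is
    trivial. *)
Lemma degree_one_exponents_entry (R : realType) (n : nat)
    (F : based_sequence R n) k (i : basis_index F (k + 1))
    (j : basis_index F k) (m : 'rV[int]_n) :
  degree_one_exponents (Tagged (basis_index F) i) (Tagged (basis_index F) j) m
    <-> m \in msupp (mx_entry i j).
Proof.
by split=> [[e]|ijm]; [rewrite (eq_irrelevance e erefl)|exists erefl].
Qed.

(** The basis in degree [k] is the fibre of [g] over [k], and each matrix entry has support [E] at
    its pair of indices. *)
Lemma exists_matrix_sequence (R : realType) (n : nat) (V : finType)
    (g : V -> int) (E : V -> V -> set 'rV[int]_n) :
  (forall u v, finite_set (E u v)) ->
  exists (F : based_sequence R n) (lab : indices F -> V),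
    [/\ injective lab, forall v, exists i, lab i = v,
        forall i, tag i = g (lab i)
      & forall i j m, degree_one_exponents i j m <->
          tag i = tag j + 1 /\ E (lab i) (lab j) m].
Proof.
move=> Efin; pose I k : finType := {v : V | g v == k}.
pose d k (i : I (k + 1)) (j : I k) : laurent R[i] n :=
  laurent_of_support R[i] (fset_set (E (val i) (val j))).
have Ibd : exists N : nat, forall k, (N < `|k|)%N -> I k -> False.
  (* Beyond the largest absolute value of [g] every fibre is empty. *)
  exists (\max_v `|g v|)%N => k + [v /eqP vk].
  by rewrite -vk ltnNge leq_bigmax.
pose F := matrix_sequence d Ibd.
exists F, (fun i : indices F => val (tagged i : I (tag i))); split.
- move=> [k [u uk]] [l [v vl]] /= uv; subst v.
  have kl : k = l by rewrite -(eqP uk) -(eqP vl).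
  by subst l; rewrite (bool_irrelevance uk vl).
- by move=> v; exists (Tagged I (exist (fun u => g u == g v) v (eqxx _))).
- by case=> k [v /= /eqP].
- move=> [k i] [l j] m; have [kl|kl] := eqVneq k (l + 1); last first.
    split=> [/degree_one_exponents_tag /=|[/= + _]] => /eqP;
      by rewrite (negPf kl).
  subst k; split=> [ijm|[_]].
    split=> //; have := (degree_one_exponents_entry _ _ _).1 ijm.
    rewrite matrix_sequence_entry.
    by rewrite msupp_laurent_of_support in_fset_set ?Efin // => /set_mem.
  move=> Em; apply/degree_one_exponents_entry; rewrite matrix_sequence_entry.
  by rewrite msupp_laurent_of_support in_fset_set ?Efin //; apply: mem_set.
Qed.

(** * Reconstruction of a sequence from a complex *)

Lemma seq_complex_of_generated (R : realType) (n : nat)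
    (X : forall k, set (singular R n k)) (deg : X 0%N -> int) :
  finite_complex X -> linear_complex X ->
  edges_generated deg -> simplices_generated X ->
  exists (F : based_sequence R n) (x : indices F -> 'rV[R]_n),
    injective (fun i => torus_proj (x i)) /\ forall k, X k = seq_complex x k.
Proof.
move=> X_finite X_linear Xedges Xsimplices.
have Xk_finite k : finite_set (X k).
  apply: (@finite_preimage _ _ _ (fun c => Tagged (singular R n) c) _ X_finite).
  by move=> c c' _ _; exact: eq_from_Tagged.
have [V [v [v_inj Xv]]] := finite_set_enum (Xk_finite 0%N).
have vX l : v l \in X 0%N by rewrite Xv; apply: mem_set; exists l.
pose w l : X 0%N := exist (fun c => c \in X 0%N) _ (vX l).
have /choice[y yE] l : exists z, v l = lin_simplex [tuple z].
  have [p ->] := X_linear _ _ (set_mem (vX l)).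
  by exists (tnth p ord0); rewrite -vertex_tuple.
(* Edges of every degree are recorded; only those between consecutive degrees enter the
   differentials. *)
pose E u l : set 'rV[int]_n :=
  [set m | X 1%N (lin_simplex [tuple y l; y u + map_mx intr m])].
(* Distinct [m] give distinct edges, because a common translation fixing the source [y l] is zero;
   finiteness of [X 1] then passes to [E]. *)
have Efin u l : finite_set (E u l).
  apply: (finite_preimage _ (Xk_finite 1%N)) => m m' _ _.
  move=> /lin_edge_eqP[c [yc ym]].
  move: ym; have -> : c = 0.
    apply: (@shift_inj R); rewrite map_mx0; apply: (addrI (y l)).
    by rewrite addr0.
  by rewrite map_mx0 addr0 => /addrI/shift_inj.
have [F [lab [lab_inj lab_surj lab_deg labE]]] :=
  @exists_matrix_sequence R n V (fun l => deg (w l)) E Efin.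
pose x i := y (lab i).
have xE i : lin_simplex [tuple x i] = v (lab i) by rewrite yE.
have x_inj : injective (fun i => torus_proj (x i)).
  by move=> i j /torus_projP/lin_vertex_eqP; rewrite !xE => /v_inj/lab_inj.
have X0 : X 0%N = seq_complex x 0.
  rewrite Xv; apply/seteqP; split=> c.
    move=> [l _ <-]; have [i <-] := lab_surj l; rewrite -xE.
    by apply/seq_complex_vertexP; exists i, 0; rewrite map_mx0 addr0.
  move=> Yc; have [p pE] := seq_complex_linear Yc; move: Yc.
  rewrite pE (vertex_tuple p) => /seq_complex_vertexP[i [a ->]].
  by exists (lab i) => //; rewrite -xE; apply/lin_vertex_eqP; exists a.
have deg_tag (u : X 0%N) i : val u = lin_simplex [tuple x i] -> deg u = tag i.
  by move=> uE; rewrite lab_deg; congr deg; apply: val_inj; rewrite uE xE.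
have X1 : X 1%N = seq_complex x 1.
  (* Once the degree-one edges agree, both edge sets are generated by the same chains. *)
  have D : unit_edges x = [set c | X 1%N c /\ has_degree deg c 1].
    exact: unit_edgesE.
  have XY p q : X 1%N (lin_simplex [tuple p; q]) <->
                seq_complex x 1 (lin_simplex [tuple p; q]).
    by rewrite (seq_complex_edges_generated x_inj) D -X0; exact: Xedges.
  apply/seteqP; split=> c Xc.
    have [p pE] := X_linear _ _ Xc.
    by move: Xc; rewrite pE (edge_tuple p) => /XY.
  have [p pE] := seq_complex_linear Xc.
  by move: Xc; rewrite pE (edge_tuple p) => /XY.
(* In dimension at least two, both families satisfy the same criterion on vertices and consecutive
   edges. *)
exists F, x; split=> // -[//|[//|k]].
have XY (p : k.+3.-tuple 'rV[R]_n) :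
    X k.+2 (lin_simplex p) <-> seq_complex x k.+2 (lin_simplex p).
  rewrite (seq_complex_simplices_generated x_inj) // -X0 -X1.
  exact: Xsimplices.
apply/seteqP; split=> c Xc.
  by have [p pE] := X_linear _ _ Xc; move: Xc; rewrite pE => /XY.
by have [p pE] := seq_complex_linear Xc; move: Xc; rewrite pE => /XY.
Qed.

Theorem proposition3p10 (R : realType) (n : nat)
    (X : forall k : nat, set (singular R n k))
    (X_complex : semisimplicial X) (X_finite : finite_complex X)
    (X_linear : linear_complex X) (X_distinct : distinct_vertices X) :
  (exists (F : based_sequence R n) (x : indices F -> 'rV[R]_n),
     injective (fun i => torus_proj (x i)) /\
     forall k : nat, X k = seq_complex x k) <->
  (exists deg : X 0%N -> int, edges_generated deg /\ simplices_generated X).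
Proof.
split=> [[F [x [x_inj XE]]]|[deg [Xedges Xsimplices]]]; last first.
  exact: seq_complex_of_generated.
(* Equality of the whole families also rewrites the type of [deg]. *)
have -> : X = seq_complex x by exact: functional_extensionality_dep.
exact: generated_of_seq_complex.
Qed.
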